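(* Let $\varepsilon$ be a primitive cubic root of unity and $K=\mathbb{Q}(\varepsilon)$. Let $p$ be a prime natural number with $p\equiv 1\pmod 3$, let $p_1$ be a prime element of $\mathbb{Z}[\varepsilon]$ with $p_1\mid p$, let $l$ be a positive integer, let $\alpha\in K^*$, and consider the $K_{p_1}$-algebra $A=\left(\frac{\alpha,\,p^{3l}}{K_{p_1},\varepsilon}\right)$. Let $P$ be a prime ideal in the ring of integers of the field $L=K(\sqrt[3]{\alpha})$ lying above $p_1$. Then $p^{3l}\in N_{L_P/K_{p_1}}(L_P^* )$ and the local Artin symbol $\left(\frac{L_P/K_{p_1}}{(p^{3l})}\right)$ is the identity in the Galois group $\mathrm{Gal}(L_P/K_{p_1})$.
   Context: $\mathbb{Z}[\varepsilon]$ is the ring of integers of $K$; $K_{p_1}$ denotes the completion of $K$ at the prime ideal $p_1\mathbb{Z}[\varepsilon]$, and $L_P$ denotes the completion of $L$ at $P$. $N_{L_P/K_{p_1}}$ is the norm map. For a field $F$ containing $\varepsilon$ and $a,b\in F^*$, the symbol algebra $\left(\frac{a,b}{F,\varepsilon}\right)$ is the unital associative $F$-algebra generated by $x,y$ with relations $x^3=a$, $y^3=b$, $yx=\varepsilon xy$. The local Artin symbol $\left(\frac{L_P/K_{p_1}}{(a)}\right)$, for $a\in K_{p_1}^*$, is the image of $a$ under the local Artin (reciprocity) map $K_{p_1}^*\to \mathrm{Gal}(L_P/K_{p_1})$ of the abelian extension $L_P/K_{p_1}$. *)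

(* Defs.v *)
From HB Require Import structures.
From mathcomp Require Import all_boot all_order all_algebra all_fingroup all_solvable all_field.
Set Implicit Arguments.
Unset Strict Implicit.
Unset Printing Implicit Defensive.
Import GRing.Theory.
Local Open Scope ring_scope.

(* Subrings and ideals of a field are given by their membership predicates. *)

Definition Zadjoin (F : fieldType) (e : F) : F -> Prop :=
  fun x => exists q : {poly int}, x = (map_poly intr q).[e].

Definition ring_of_integers (F : fieldType) : F -> Prop :=
  fun x => integralOver (intr : int -> F) x.

Definition divides_in (F : fieldType) (R : F -> Prop) (x y : F) : Prop :=
  exists z, R z /\ y = x * z.

Definition prime_element (F : fieldType) (R : F -> Prop) (x : F) : Prop :=
  [/\ R x, x <> 0, ~ divides_in R x 1 &
      forall a b, R a -> R b -> divides_in R x (a * b) ->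
        divides_in R x a \/ divides_in R x b].

Definition prime_ideal (F : fieldType) (R P : F -> Prop) : Prop :=
  [/\ forall x, P x -> R x,
      P 0 /\ (forall x y, P x -> P y -> P (x + y)),
      forall a x, R a -> P x -> P (a * x),
      ~ P 1 &
      forall a b, R a -> R b -> P (a * b) -> P a \/ P b].

(* I ^ 0 is the whole ring; I ^ n.+1 is the set of finite sums of products. *)
Fixpoint ideal_pow (F : fieldType) (R I : F -> Prop) (n : nat) : F -> Prop :=
  if n is m.+1 then
    fun x => exists (k : nat) (a b : 'I_k -> F),
      [/\ forall i, I (a i), forall i, ideal_pow R I m (b i) &
          x = \sum_(i < k) a i * b i]
  else R.

(* Valuations are integer valued and only meaningful on nonzero elements;
   [val_ge w n x] is "w x >= n" under the convention w 0 = +oo. *)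
Definition val_ge (F : fieldType) (w : F -> int) (n : int) (x : F) : Prop :=
  x = 0 \/ (n <= w x)%R.

Definition discrete_valuation (F : fieldType) (w : F -> int) : Prop :=
  (forall x y, x <> 0 -> y <> 0 -> w (x * y) = w x + w y) /\
  (forall n x y, val_ge w n x -> val_ge w n y -> val_ge w n (x + y)).

(* The P-adic valuation of F = Frac R: on R it is the largest n with x in P ^ n,
   and multiplicativity extends it to F. *)
Definition adic_valuation (F : fieldType) (R P : F -> Prop) (v : F -> int) :
    Prop :=
  (forall x y, x <> 0 -> y <> 0 -> v (x * y) = v x + v y) /\
  (forall x, R x -> x <> 0 ->
     forall n : nat, (n%:Z <= v x)%R <-> ideal_pow R P n x).

Definition val_complete (F : fieldType) (w : F -> int) : Prop :=
  forall s : nat -> F,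
    (forall n : int, exists N : nat, forall i j : nat,
       (N <= i)%N -> (N <= j)%N -> val_ge w n (s i - s j)) ->
  exists x, forall n : int, exists N : nat, forall i : nat,
       (N <= i)%N -> val_ge w n (s i - x).

Definition completion_at (F : fieldType) (R P : F -> Prop)
    (Fh : fieldType) (w : Fh -> int) (j : {rmorphism F -> Fh}) : Prop :=
  [/\ discrete_valuation w,
      adic_valuation R P (fun x => w (j x)),
      forall (y : Fh) (n : int), exists x : F, val_ge w n (y - j x) &
      val_complete w].

Definition symbol_rel (F : fieldType) (zeta a b : F) (B : algType F)
    (x y : B) : Prop :=
  [/\ x ^+ 3 = a%:A, y ^+ 3 = b%:A & y * x = zeta *: (x * y)].

(* The F-algebra presented by generators x, y and the relations [symbol_rel],
   through its universal property. *)
Definition is_symbol_algebra (F : fieldType) (zeta a b : F) (A : algType F) :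
    Prop :=
  exists x y : A, symbol_rel zeta a b x y /\
    forall (B : algType F) (u v : B), symbol_rel zeta a b u v ->
      (exists f : {lrmorphism A -> B}, f x = u /\ f y = v) /\
      (forall f g : {lrmorphism A -> B},
         f x = u -> f y = v -> g x = u -> g y = v -> f =1 g).

Definition is_norm (F : fieldType) (E : splittingFieldType F) (a : F) : Prop :=
  exists x : E, x <> 0 /\ galNorm 1%AS {:E}%AS x = a%:A.

Definition abelian_ext (F : fieldType) (E : splittingFieldType F) : Prop :=
  galois 1%AS {:E}%AS /\ abelian 'Gal({:E}%AS / 1%AS)%g.

Definition residue_field_card (F : fieldType) (w : F -> int) (q : nat) : Prop :=
  exists r : 'I_q -> F,
    (forall i, val_ge w 0 (r i)) /\
    (forall x, val_ge w 0 x -> exists! i, val_ge w 1 (x - r i)).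

(* u is the valuation of E and E/F is unramified: u extends the normalized
   valuation w without enlarging its value group (the residue fields being
   finite, the residue extension is automatically separable). *)
Definition unramified_val (F : fieldType) (w : F -> int)
    (E : splittingFieldType F) (u : E -> int) : Prop :=
  discrete_valuation u /\ forall c : F, c <> 0 -> u c%:A = w c.

(* The local Artin map of a nonarchimedean local field F with normalized
   valuation w, as the family of its components F^* -> Gal(E/F) for E/F
   finite abelian.  These are the properties by which the local reciprocity law
   determines it: compatible homomorphisms, inducing isomorphisms
   between F^* modulo norms from E^* and Gal(E/F), sending uniformizers to the (arithmetic) Frobenius
   when E/F is unramified.  The values of phi at 0 and at nonabelian E are
   irrelevant. *)
Definition is_local_artin_map (F : fieldType) (w : F -> int)
    (phi : forall E : splittingFieldType F, F -> gal_of {:E}) : Prop :=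
  [/\ forall E, abelian_ext E -> forall a b, a <> 0 -> b <> 0 ->
        phi E (a * b) = (phi E a * phi E b)%g,
      forall (E E' : splittingFieldType F) (f : {lrmorphism E -> E'}),
        abelian_ext E -> abelian_ext E' -> forall a, a <> 0 ->
        forall x, f (phi E a x) = phi E' a (f x),
      forall E, abelian_ext E -> forall a, a <> 0 ->
        (phi E a = 1%g <-> is_norm E a),
      forall E, abelian_ext E -> forall s : gal_of {:E},
        exists a, a <> 0 /\ phi E a = s &
      forall (E : splittingFieldType F) (u : E -> int) (q : nat) (pi : F),
        abelian_ext E -> unramified_val w u -> residue_field_card w q ->
        pi <> 0 -> w pi = 1 ->
        forall x : E, val_ge u 0 x -> val_ge u 1 (phi E pi x - x ^+ q)].

(* Main.v *)
Require Import Defs.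
From mathcomp Require Import all_boot all_order all_algebra all_fingroup all_solvable all_field.
From mathcomp Require Import zify ring.
Set Implicit Arguments.
Unset Strict Implicit.
Unset Printing Implicit Defensive.
Import GRing.Theory.
Local Open Scope ring_scope.

(** The element p ^ (3 l) is the cube of p ^ l, and it lies in the base field.
    So everything follows once the extension LP / Kp is known to be Kummer of
    exponent dividing 3: its Galois group then has order 1 or 3, and an element c of Kp
    has norm c in the first case and c ^ 3 in the second, so that the cube
    c ^ 3 is the norm of c ^ 3 or of c ([kummer_norm_exp]).  The kernel of the
    Artin map being the norm group, the Artin symbol of p ^ (3 l) is trivial.

    What needs work is that LP is generated over Kp by a cube root of alpha.
    The subfield Kp(theta) contains the image of L, hence is dense in LP, and
    LP / Kp being normal of characteristic 0, it is the fixed field of the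
    automorphisms of LP over it.  So it is enough that such an automorphism s is continuous
    ([dense_subfield_full]).  Continuity comes from the uniqueness of the
    valuation of a complete field.  As p is odd, every principal unit is the
    square of a principal unit ([principal_unit_sqrt]), hence a 2 ^ k-th power
    for every k, so any integer valued valuation vanishes on it
    ([principal_unit_val0]).  Applied to the valuation x |-> v (s x), which
    takes the same value as v at p, this bounds v (s x) below in terms of v x
    ([second_val_continuous]). *)

(** * Discrete valuations *)

Section Valuation.

Variables (F : fieldType) (w : F -> int).
Hypothesis wval : discrete_valuation w.

Lemma valM x y : x <> 0 -> y <> 0 -> w (x * y) = w x + w y.
Proof. exact: wval.1. Qed.

Lemma val1 : w 1 = 0.
Proof.
have n1 : (1 : F) <> 0 by apply/eqP/oner_neq0.
by have := valM n1 n1; rewrite mul1r; lia.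
Qed.

Lemma valN1 : w (- 1) = 0.
Proof.
have n1 : (- 1 : F) <> 0 by apply/eqP; rewrite oppr_eq0 oner_neq0.
by have := valM n1 n1; rewrite mulrNN mul1r val1; lia.
Qed.

Lemma valV x : x <> 0 -> w x^-1 = - w x.
Proof.
move=> /eqP nx; have := valM (elimN eqP nx) (elimN eqP (invr_neq0 nx)).
by rewrite mulfV // val1; lia.
Qed.

Lemma valX x n : x <> 0 -> w (x ^+ n) = w x *+ n.
Proof.
move=> nx; elim: n => [|n IHn]; first by rewrite val1.
rewrite exprS valM // ?IHn ?mulrS //.
by apply/eqP; rewrite expf_neq0 //; apply/eqP.
Qed.

Lemma val_geD n x y : val_ge w n x -> val_ge w n y -> val_ge w n (x + y).
Proof. exact: wval.2. Qed.

Lemma val_ge_trans m n x : (n <= m)%R -> val_ge w m x -> val_ge w n x.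
Proof. by move=> lenm [-> | lemw]; [left | right; lia]. Qed.

Lemma val_geM m n x y :
  val_ge w m x -> val_ge w n y -> val_ge w (m + n) (x * y).
Proof.
case: (eqVneq x 0) => [-> | /eqP nx]; first by left; rewrite mul0r.
case: (eqVneq y 0) => [-> | /eqP ny]; first by left; rewrite mulr0.
by case=> // lex; case=> // ley; right; rewrite valM //; lia.
Qed.

Lemma val_ge1 : val_ge w 0 1.
Proof. by right; rewrite val1. Qed.

Lemma val_geN n x : val_ge w n x -> val_ge w n (- x).
Proof.
move=> gex; rewrite -mulN1r -[n]add0r; apply: val_geM => //.
by right; rewrite valN1.
Qed.

Lemma val_geB n x y : val_ge w n x -> val_ge w n y -> val_ge w n (x - y).
Proof. by move=> gex /val_geN; apply: val_geD. Qed.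

Lemma val_ge_nat n : val_ge w 0 n%:R.
Proof.
elim: n => [|n IHn]; first by left.
by rewrite -natr1; apply: val_geD => //; apply: val_ge1.
Qed.

Lemma val_ge_all x : (forall n, val_ge w n x) -> x = 0.
Proof. by move=> /(_ (w x + 1)) [] // ; lia. Qed.

Lemma val_ge1_neq0 x : val_ge w 1 (x - 1) -> x <> 0.
Proof.
move=> + x0; rewrite x0 sub0r => -[/eqP|]; last by rewrite valN1.
by rewrite oppr_eq0 oner_eq0.
Qed.

(** The residue characteristic is the odd number p, or divides it: were 2 in
    the maximal ideal, so would be p - 2 (p / 2) = 1. *)
Lemma val_nat2 p : odd p -> val_ge w 1 p%:R -> (2%:R : F) <> 0 /\ w 2%:R = 0.
Proof.
move=> oddp gep.
have no_ge2 : ~ val_ge w 1 2%:R.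
  move=> ge2; have []: val_ge w 1 1.
  - have -> : (1 : F) = p%:R - 2%:R * (p./2)%:R.
      have := congr1 (fun n => n%:R : F) (odd_double_half p).
      by rewrite oddp natrD -mul2n natrM => <-; rewrite addrK.
    apply: val_geB => //; rewrite -[1]addr0.
    by apply: val_geM => //; apply: val_ge_nat.
  - by move/eqP; rewrite oner_eq0.
  - by rewrite val1.
split=> [two0|]; first by apply: no_ge2; left.
case: (val_ge_nat 2) => [two0 | ge0]; first by case: no_ge2; left.
have : ~ (1 <= w 2%:R)%R by move=> ge1; apply: no_ge2; right.
by move: ge0; set z := w _; lia.
Qed.

(** * Square roots of principal units *)

Section SquareRoots.

Hypothesis wcomplete : val_complete w.
Hypothesis nz2 : (2%:R : F) <> 0.
Hypothesis w2 : w 2%:R = 0.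

(** Hensel's lemma for Y ^ 2 - x at the approximate root 1.  The derivative
    2 y is congruent to the unit 2 along the whole iteration, so dividing the
    error by 2 instead of 2 y still gains one order of precision at each
    step. *)
Lemma principal_unit_sqrt x :
  val_ge w 1 (x - 1) -> exists2 y, val_ge w 1 (y - 1) & y ^+ 2 = x.
Proof.
move=> x1.
pose d y := (x - y ^+ 2) / 2%:R.
pose s n := iter n (fun y => y + d y) 1.
have sS n : s n.+1 = s n + d (s n) by [].
have half n z : val_ge w n z -> val_ge w n (z / 2%:R).
  move=> gez; rewrite -[n]addr0; apply: val_geM => //.
  by right; rewrite valV // w2.
have sP n : val_ge w 1 (s n - 1) /\ val_ge w (n%:Z + 1) (x - s n ^+ 2).
  elim: n => [|n [IH1 IHn]].
    by rewrite /s /= subrr expr1n; split; [left | exact: x1].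
  have gd : val_ge w (n%:Z + 1) (d (s n)) by apply: half.
  split.
    rewrite sS addrAC; apply: val_geD => //.
    by apply: val_ge_trans gd; lia.
  (* With e = x - s_n ^ 2 = 2 d, the next error is 2 d (1 - s_n) - d ^ 2, and
     both 1 - s_n and d are in the maximal ideal. *)
  have -> : x - s n.+1 ^+ 2 = d (s n) * (- 2%:R * (s n - 1)) - d (s n) * d (s n).
    rewrite sS.
    have : x - s n ^+ 2 = 2%:R * d (s n).
      by rewrite /d mulrC divfK //; apply/eqP.
    move/(canRL (subrK _)) => {1}->; ring.
  apply: val_geB.
    have: val_ge w ((n%:Z + 1) + (0 + 1)) (d (s n) * (- 2%:R * (s n - 1))).
      apply: val_geM => //; apply: val_geM => //.
      by apply: val_geN; right; rewrite w2.
    by apply: val_ge_trans; lia.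
  by have := val_geM gd gd; apply: val_ge_trans; lia.
have cauchy N k : val_ge w (N%:Z + 1) (s (N + k)%N - s N).
  elim: k => [|k IHk]; first by rewrite addn0 subrr; left.
  rewrite addnS sS addrAC; apply: val_geD => //.
  by apply: half; have [_] := sP (N + k)%N; apply: val_ge_trans; lia.
have [n | y yP] := @wcomplete s.
  exists `|n|%N => i j lei lej.
  have close k : (`|n| <= k)%N -> val_ge w n (s k - s `|n|%N).
    move=> /subnKC <-; apply: val_ge_trans (cauchy _ _); lia.
  have -> : s i - s j = (s i - s `|n|%N) - (s j - s `|n|%N) by ring.
  by apply: val_geB => //; apply: close.
have y1 : val_ge w 1 (y - 1).
  have [N /(_ N (leqnn _)) leN] := yP 1.
  have -> : y - 1 = (s N - 1) - (s N - y) by ring.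
  by apply: val_geB => //; have [] := sP N.
exists y => //; apply/esym/eqP; rewrite -subr_eq0; apply/eqP.
apply: val_ge_all => n; have [N /(_ (N + `|n|)%N (leq_addr _ _))] := yP `|n|%:Z.
set i := (N + _)%N => leN; have [si1 si2] := sP i.
have -> : x - y ^+ 2 =
   (x - s i ^+ 2) + (s i - y) * ((s i - 1) + (y - 1) + 2%:R) by ring.
apply: val_geD; first by apply: val_ge_trans si2; rewrite /i; lia.
have : val_ge w (`|n|%:Z + 0) ((s i - y) * ((s i - 1) + (y - 1) + 2%:R)).
  apply: val_geM => //; apply: val_geD; last exact: val_ge_nat.
  by apply: (@val_ge_trans 1) => //; apply: val_geD.
by apply: val_ge_trans; lia.
Qed.

End SquareRoots.

End Valuation.

(** * Uniqueness of the valuation of a complete field *)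

Section SecondValuation.

Variables (F : fieldType) (w w' : F -> int).
Hypothesis wval : discrete_valuation w.
Hypothesis w'val : discrete_valuation w'.
Hypothesis wcomplete : val_complete w.
Variable p : nat.
Hypothesis oddp : odd p.
Hypothesis nzp : (p%:R : F) <> 0.
Hypothesis gep : val_ge w 1 p%:R.

(** A principal unit is a square of a principal unit, so a nonzero value of w'
    would be divisible by arbitrarily large powers of 2: here, infinite descent
    on its absolute value. *)
Lemma principal_unit_val0 x : val_ge w 1 (x - 1) -> w' x = 0.
Proof.
have [nz2 w2] := val_nat2 wval oddp gep.
have [m] := ubnP `|w' x|%N; elim: m x => // m IHm x lem x1.
have [y y1 yx] := principal_unit_sqrt wval wcomplete nz2 w2 x1.
have w'x : w' x = w' y *+ 2.
  by rewrite -yx valX //; apply: val_ge1_neq0 y1.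
case: (eqVneq (w' y) 0) => [w'y0 | nz]; first by rewrite w'x w'y0.
by rewrite w'x (IHm y) //; move: w'x lem nz; rewrite mulr2n; lia.
Qed.

(** 1 + x is a principal unit for w, hence a unit for w', so that
    x = (1 + x) - 1 is w'-integral. *)
Lemma val_ge1_second x : val_ge w 1 x -> val_ge w' 0 x.
Proof.
case: (eqVneq x 0) => [-> | /eqP nx ge1]; first by left.
have x1 : val_ge w 1 (x + 1 - 1) by rewrite addrK.
have -> : x = x + 1 - 1 by rewrite addrK.
apply: val_geB => //; last exact: val_ge1.
by right; rewrite principal_unit_val0.
Qed.

(** Dividing by powers of p turns the integrality of [val_ge1_second] into
    arbitrarily strong bounds. *)
Lemma second_val_continuous :
  (1 <= w' p%:R)%R -> forall n, exists m, forall x, val_ge w m x -> val_ge w' n x.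
Proof.
move=> w'p n; exists (w p%:R *+ `|n| + 1) => x gex.
have nzpn : p%:R ^+ `|n| != 0 :> F by rewrite expf_neq0 //; apply/eqP.
have /val_ge1_second : val_ge w 1 (x / p%:R ^+ `|n|).
  rewrite -[1](addrK (w p%:R *+ `|n|)) [1 + _]addrC.
  apply: val_geM => //; right; rewrite valV ?valX //; exact/eqP.
have ge_pn : val_ge w' n (p%:R ^+ `|n|).
  right; rewrite valX //; apply: (@Order.POrderTheory.le_trans _ _ (1 *+ `|n|)).
    by rewrite -mulr_natr; lia.
  by rewrite Num.Theory.lerMn2r w'p orbT.
by move/val_geM => /(_ w'val _ _ ge_pn); rewrite add0r divfK.
Qed.

End SecondValuation.

(** An automorphism over U fixes a dense subset, and it is continuous because
    v \o s is again a discrete valuation, positive at p; so it is trivial, and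
    U is the fixed field of the trivial group. *)
Lemma dense_subfield_full (F : fieldType) (E : splittingFieldType F)
    (v : E -> int) (p : nat) (U : {subfield E}) :
  discrete_valuation v -> val_complete v ->
  odd p -> (p%:R : E) <> 0 -> val_ge v 1 p%:R ->
  galois U {:E} ->
  (forall y n, exists2 x, x \in U & val_ge v n (y - x)) ->
  U = {:E}%VS :> {vspace E}.
Proof.
move=> vval vcomplete oddp nzp gep galUE dense.
apply/eqP; rewrite eqEsubv subvf; apply/subvP => y _.
rewrite -(galois_fixedField galUE); apply/fixedFieldP; first exact: memvf.
move=> s Us; pose v' z := v (s z).
have snz z : z <> 0 -> s z <> 0 by move=> /eqP nz; apply/eqP; rewrite fmorph_eq0.
have sge n z : val_ge v n (s z) <-> val_ge v' n z.
  split=> -[]; try by right.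
  - by move/eqP; rewrite fmorph_eq0 => /eqP; left.
  - by move=> ->; left; rewrite rmorph0.
have v'val : discrete_valuation v'.
  split=> [a b /snz na /snz nb | n a b]; first by rewrite /v' rmorphM valM.
  by rewrite -!sge rmorphD; apply: val_geD.
have v'p : (1 <= v' p%:R)%R by rewrite /v' rmorph_nat; case: gep.
apply/eqP; rewrite -subr_eq0; apply/eqP; apply: (@val_ge_all _ v) => n.
have [m mP] := second_val_continuous vval v'val vcomplete oddp nzp gep v'p n.
have [x Ux [lem len]] : exists2 x, x \in U & val_ge v m (y - x) /\ val_ge v n (y - x).
  have [x Ux lex] := dense y (`|m| + `|n|)%:Z.
  by exists x => //; split; apply: val_ge_trans lex; lia.
have -> : s y - y = s (y - x) - (y - x).
  by rewrite rmorphB /= (fixed_gal (subvf U) Us Ux); ring.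
by apply: val_geB => //; apply/sge/mP.
Qed.

(** * Kummer extensions of prime exponent *)

Section Kummer.

Variables (F : fieldType) (E : splittingFieldType F) (n : nat).
Variables (z a : F) (t : E).
Hypothesis prn : prime n.
Hypothesis primz : n.-primitive_root z.
Hypothesis nza : a <> 0.
Hypothesis ta : t ^+ n = a%:A.
Hypothesis Et : <<1; t>>%VS = {:E}%VS.
Hypothesis galE : galois 1%AS {:E}%AS.

Lemma gal_eq_generator (s s' : gal_of {:E}) : s t = s' t -> s = s'.
Proof.
move=> st; apply/eqP/gal_eqP => y _.
have : y \in <<1; t>>%VS by rewrite Et memvf.
case/Fadjoin_polyP => q q1 ->; rewrite -!horner_map /= st.
have fixq (r : gal_of {:E}) : map_poly r q = q.
  apply: (fixedPoly_gal (sub1v _) _ q1).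
  by rewrite gal_kHom ?sub1v // k1HomE ahomWin.
by rewrite !fixq.
Qed.

Lemma gal_generator (s : gal_of {:E}) : exists i, s t = (z ^+ i)%:A * t.
Proof.
have nzt : t != 0.
  apply: contra_notN nza => /eqP t0; apply/eqP.
  have /eqP := ta; rewrite t0 expr0n gtn_eqF ?prime_gt0 // eq_sym.
  by rewrite scaler_eq0 oner_eq0 orbF.
have primzE : n.-primitive_root (z%:A : E) by rewrite (fmorph_primitive_root (in_alg E)).
have root1 : (s t / t) ^+ n = 1.
  rewrite exprMn exprVn -rmorphXn /= ta linearZ rmorph1 mulfV //.
  by rewrite scaler_eq0 oner_eq0 orbF; apply/eqP.
have [i st] := prim_rootP primzE root1.
by exists i; rewrite -[_%:A]/(in_alg E _) rmorphXn /= -st divfK.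
Qed.

Lemma gal_iter_generator (s : gal_of {:E}) i k :
  s t = (z ^+ i)%:A * t -> (s ^+ k)%g t = (z ^+ (i * k))%:A * t.
Proof.
move=> st; elim: k => [|k IHk]; first by rewrite gal_id muln0 scale1r mul1r.
rewrite expgSr galM ?memvf // IHk rmorphM /= linearZ rmorph1 st.
by rewrite mulrA -[RHS]/(in_alg E _ * t) mulnSr exprD rmorphM.
Qed.

Lemma kummer_exponent (s : gal_of {:E}) : (s ^+ n = 1)%g.
Proof.
have [i /gal_iter_generator si] := gal_generator s.
apply: gal_eq_generator.
have zin : z ^+ (i * n) = 1.
  by rewrite mulnC exprM (prim_expr_order primz) expr1n.
by rewrite si gal_id zin scale1r mul1r.
Qed.

Lemma kummer_card_le : (#|'Gal({:E}%AS / 1%AS)%g| <= n)%N.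
Proof.
have <- : adjoin_degree 1%AS t = #|'Gal({:E}%AS / 1%AS)%g|.
  by rewrite -(galois_dim galE) adjoin_degreeE Et.
rewrite -ltnS -size_minPoly.
rewrite -(size_XnsubC (a%:A : E) (prime_gt0 prn)); apply: dvdp_leq.
  by rewrite -size_poly_eq0 size_XnsubC ?prime_gt0.
apply: minPoly_dvdp.
  by rewrite rpredB ?rpredX ?polyOverX // polyOverC rpredZ ?rpred1.
by rewrite /root !hornerE ta subrr.
Qed.

(** Every automorphism has order dividing the prime n, so by Cauchy's theorem the
    order of the group is a power of n; it is at most n because t is a root of
    X ^ n - a. *)
Lemma kummer_card :
  #|'Gal({:E}%AS / 1%AS)%g| = 1%N \/ #|'Gal({:E}%AS / 1%AS)%g| = n.
Proof.
have ngroup : (n.-group 'Gal({:E}%AS / 1%AS))%g.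
  apply/pgroupP => q prq /(Cauchy prq)[s _ os].
  have : (q %| n)%N by rewrite -os order_dvdn kummer_exponent.
  by rewrite dvdn_prime2.
have := kummer_card_le; rewrite (card_pgroup ngroup).
case: (logn _ _) => [|[|k]]; [by left | by right |].
rewrite -{2}(expn1 n) leq_exp2l ?prime_gt1 //.
Qed.

Lemma kummer_abelian : abelian 'Gal({:E}%AS / 1%AS)%g.
Proof.
have [/card1_trivg -> | card_n] := kummer_card; first exact: abelian1.
by apply/cyclic_abelian/prime_cyclic; rewrite card_n.
Qed.

(** Base field elements are raised by the norm to the order of the group: if
    that is n, then c has norm c ^ n; if it is 1, then c ^ n is its own norm. *)
Lemma kummer_norm_exp (c : F) : c <> 0 -> is_norm E (c ^+ n).
Proof.
have normE (b : F) : galNorm 1%AS {:E}%AS (b%:A : E)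
                     = (b ^+ #|'Gal({:E}%AS / 1%AS)%g|)%:A.
  rewrite -[RHS]/(in_alg E _) rmorphXn /= -prodr_const; apply: eq_bigr => s _.
  by rewrite linearZ rmorph1.
move=> /eqP nzc; have [card1 | cardn] := kummer_card.
  exists (c ^+ n)%:A; split; last by rewrite normE card1.
  by apply/eqP; rewrite scaler_eq0 oner_eq0 orbF expf_neq0.
by exists c%:A; split; [apply/eqP; rewrite scaler_eq0 oner_eq0 orbF | rewrite normE cardn].
Qed.

End Kummer.

(** * The extension of completions *)

Theorem proposition3p3
  (* K = Q(eps) *)
  (K : fieldExtType rat) (eps : K)
  (heps : 3.-primitive_root eps) (hK : (<<1; eps>> = {:K})%VS)
  (* the primes p and p1 *)
  (p : nat) (hp : prime p) (hp3 : p = 1 %[mod 3])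
  (p1 : K) (hp1 : prime_element (Zadjoin eps) p1)
  (hp1p : divides_in (Zadjoin eps) p1 p%:R)
  (l : nat) (hl : (0 < l)%N)
  (alpha : K) (halpha : alpha <> 0)
  (* L = K(theta), theta a cube root of alpha *)
  (L : fieldExtType K) (theta : L)
  (htheta : theta ^+ 3 = alpha%:A) (hL : (<<1; theta>> = {:L})%VS)
  (* P is a prime ideal of the ring of integers of L above p1 *)
  (P : L -> Prop) (hP : prime_ideal (@ring_of_integers L) P)
  (hPp1 : forall a : K, Zadjoin eps a ->
            (P a%:A <-> divides_in (Zadjoin eps) p1 a))
  (* the completion of K at p1 Z[eps] *)
  (Kp : fieldType) (w : Kp -> int) (jK : {rmorphism K -> Kp})
  (hKp : completion_at (Zadjoin eps) (divides_in (Zadjoin eps) p1) w jK)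
  (* the completion of L at P, an extension of Kp through the continuous map
     extending K -> L *)
  (LP : splittingFieldType Kp) (wP : LP -> int) (jL : {rmorphism L -> LP})
  (hLP : completion_at (@ring_of_integers L) P wP jL)
  (hcompat : forall a : K, jL a%:A = (jK a)%:A)
  (hcont : forall n : int, exists m : int, forall c : Kp,
             val_ge w m c -> val_ge wP n (c%:A : LP))
  (* the symbol algebra (alpha, p^(3l) / Kp, eps) *)
  (A : algType Kp)
  (hA : is_symbol_algebra (jK eps) (jK alpha) (p%:R ^+ (3 * l)) A)
  (* the local Artin map of Kp *)
  (phi : forall E : splittingFieldType Kp, Kp -> gal_of {:E})
  (hphi : is_local_artin_map w phi) :
  is_norm LP (p%:R ^+ (3 * l)) /\ phi LP (p%:R ^+ (3 * l)) = 1%g.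

Proof.
case: hKp hLP => _ _ _ _ [wPval wPadic wPdense wPcomplete].
have char0 : [pchar LP] =i pred0.
  move=> q; rewrite (fmorph_pchar jL) (pchar_lalg L) (pchar_lalg K).
  exact: Num.Theory.pchar_num.
have nzp (R : fieldType) (f : {rmorphism R -> LP}) : (p%:R : R) <> 0.
  move=> /(congr1 f)/eqP; rewrite rmorph_nat rmorph0.
  have /(_ p) := char0; rewrite !inE hp /= => -> //.
have oddp : odd p by case: (even_prime hp) => // p2; rewrite p2 in hp3.
have Pp : P p%:R.
  have Zp : Zadjoin eps (p%:R : K).
    by exists p%:R; rewrite rmorph_nat hornerMn hornerE.
  by have := (hPp1 _ Zp).2 hp1p; rewrite scaler_nat.
have gep : val_ge wP 1 p%:R.
  right; rewrite -(rmorph_nat jL); apply/(wPadic.2 _ _ _ 1).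
  - by case: hP => /(_ _ Pp).
  - exact: (nzp _ jL).
  - exists 1, (fun=> p%:R), (fun=> 1); split=> //; last first.
      by rewrite big_ord1 mulr1.
    by move=> _; rewrite /= /ring_of_integers; apply: integral1.
(* The image of L = K(theta) is dense in LP and lies in Kp(th). *)
pose th := jL theta.
have tha : th ^+ 3 = (jK alpha)%:A by rewrite -rmorphXn htheta hcompat.
have full : <<1; th>>%VS = {:LP}%VS.
  apply: (dense_subfield_full wPval wPcomplete oddp (nzp LP idfun) gep).
    rewrite /galois subvf normalFieldf andbT /=.
    by apply/separableP => y _; apply: pcharf0_separable.
  move=> y n; have [x lex] := wPdense y n; exists (jL x) => //.
  have : x \in <<1; theta>>%VS by rewrite hL memvf.
  case/Fadjoin_polyP => q /polyOver1P[r ->] ->.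
  rewrite -horner_map; apply/Fadjoin_polyP.
  eexists; last by [].
  apply/polyOverP => i; rewrite !coef_map /= hcompat.
  by rewrite rpredZ ?rpred1.
have gal1 : galois 1%AS {:LP}%AS.
  rewrite /galois sub1v normalFieldf andbT /=.
  by apply/separableP => y _; apply: pcharf0_separable.
have primz : 3.-primitive_root (jK eps) by rewrite fmorph_primitive_root.
have nza : jK alpha <> 0 by move/eqP; rewrite fmorph_eq0 => /eqP.
have norm : is_norm LP (p%:R ^+ (3 * l)).
  rewrite mulnC exprM.
  apply: (kummer_norm_exp (isT : prime 3) primz nza tha full gal1).
  apply/eqP; rewrite expf_neq0 //; apply/eqP.
  exact: (nzp _ (in_alg LP)).
split=> //; case: hphi => _ _ phi_norm _ _.
apply/phi_norm => //; last first.
  by apply/eqP; rewrite expf_neq0 //; apply/eqP/(nzp _ (in_alg LP)).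
split=> //.
exact: (kummer_abelian (isT : prime 3) primz nza tha full gal1).
Qed.
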